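(* Let $n\ge 1$ and let $X$ be a random vector in $\mathbb{R}^n$ with a log-concave density $f$. Then $$\log \|f\|_\infty^{-1/n}\le \frac1n h(X)\le 1+\log\|f\|_\infty^{-1/n}.$$
   Context: The density is with respect to Lebesgue measure on $\mathbb{R}^n$. A density $f$ is log-concave if $f(tx+(1-t)y)\ge f(x)^t f(y)^{1-t}$ for all $x,y\in\mathbb{R}^n$ and $t\in(0,1)$. $h(X)=-\int_{\mathbb{R}^n} f\log f$ is the Shannon entropy (natural logarithm), and $\|f\|_\infty$ is the essential supremum of $f$. *)

(* Defs.v *)
From HB Require Import structures.
From mathcomp Require Import all_boot all_order all_algebra.
From mathcomp Require Import all_classical all_reals all_analysis.
From mathcomp Require Import ess_sup_inf.

Set Implicit Arguments.
Unset Strict Implicit.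
Unset Printing Implicit Defensive.

Import Order.TTheory GRing.Theory Num.Theory.
Import numFieldNormedType.Exports.

Local Open Scope classical_set_scope.
Local Open Scope ring_scope.

(* R^n, with the sigma-algebra generated by the coordinates, i.e. its Borel
   sigma-algebra.  measurableTypeR R is R with its Borel sigma-algebra, in the
   measure display over which lebesgue_measure is defined. *)
Notation rvec R n := (n.-tuple (measurableTypeR R)).

Definition tuple_cons (R : realType) (n : nat)
  (p : measurableTypeR R * rvec R n) : rvec R n.+1 :=
  [tuple of p.1 :: p.2].

Lemma measurable_tuple_cons (R : realType) (n : nat) :
  measurable_fun [set: measurableTypeR R * rvec R n] (@tuple_cons R n).
Proof. exact: (measurable_cons measurable_fst measurable_snd). Qed.

Section lebesgue_cons.
Local Open Scope ereal_scope.
Variables (R : realType) (n : nat).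
Variable mu : {sigma_finite_measure set (rvec R n) -> \bar R}.

Definition lebesgue_cons : set (rvec R n.+1) -> \bar R :=
  pushforward (@lebesgue_measure R \x mu) (@tuple_cons R n).

Let lebesgue_cons0 : lebesgue_cons set0 = 0.
Proof. by rewrite /lebesgue_cons /pushforward preimage_set0 measure0. Qed.

Let lebesgue_cons_ge0 A : 0 <= lebesgue_cons A.
Proof. by rewrite /lebesgue_cons /pushforward measure_ge0. Qed.

Let lebesgue_cons_sigma_additive : semi_sigma_additive lebesgue_cons.
Proof.
by apply: measure_semi_sigma_additive; exact: measurable_tuple_cons.
Qed.

HB.instance Definition _ := isMeasure.Build _ _ _ lebesgue_cons
  lebesgue_cons0 lebesgue_cons_ge0 lebesgue_cons_sigma_additive.

Lemma lebesgue_cons_sigma_finite : sigma_finite setT lebesgue_cons.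
Proof.
have /sigma_finiteP[F [TF ndF Foo]] := sigma_finiteT (@lebesgue_measure R).
have /sigma_finiteP[G [TG ndG Goo]] := sigma_finiteT mu.
pose hd (x : rvec R n.+1) : measurableTypeR R := thead x.
pose tl (x : rvec R n.+1) : rvec R n := [tuple of behead x].
have mhd : measurable_fun setT hd by exact: measurable_tnth.
have mtl : measurable_fun setT tl by exact: measurable_behead.
exists (fun k => hd @^-1` F k `&` tl @^-1` G k).
  apply/seteqP; split => // x _.
  have [k _ Fk] : (\bigcup_k F k) (hd x) by rewrite -TF.
  have [l _ Gl] : (\bigcup_k G k) (tl x) by rewrite -TG.
  exists (maxn k l) => //; split => /=.
    by move: (hd x) Fk; exact/subsetPset/ndF/leq_maxl.
  by move: (tl x) Gl; exact/subsetPset/ndG/leq_maxr.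
move=> k; have [mF Fk] := Foo k; have [mG Gk] := Goo k; split.
  by apply: measurableI; rewrite -[X in measurable X]setTI; [exact: mhd|exact: mtl].
rewrite /lebesgue_cons /pushforward.
rewrite (_ : _ @^-1` _ = F k `*` G k).
  by rewrite product_measure1E// lte_mul_pinfty// ge0_fin_numE.
apply/seteqP; split => -[a x] /=; rewrite /hd /tl /tuple_cons theadE /=;
  by rewrite (_ : [tuple of _] = x)//; exact: val_inj.
Qed.

HB.instance Definition _ := Measure_isSigmaFinite.Build _ _ _ lebesgue_cons
  lebesgue_cons_sigma_finite.

End lebesgue_cons.

(* The Lebesgue measure on R^n, as the n-fold product of the Lebesgue measure
   on R (a unit mass at the empty tuple when n = 0); see lebesgue_tuple_box. *)
Fixpoint lebesgue_tuple (R : realType) (n : nat) :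
    {sigma_finite_measure set (rvec R n) -> \bar R} :=
  match n with
  | 0%N => (\d_([tuple] : rvec R 0) : FiniteMeasure.type _ R)
  | m.+1 => lebesgue_cons (lebesgue_tuple R m)
  end.

Lemma lebesgue_tuple_box (R : realType) (n : nat)
    (A : 'I_n -> set (measurableTypeR R)) :
  (forall i, measurable (A i)) ->
  lebesgue_tuple R n [set x | forall i, A i (tnth x i)] =
  (\prod_(i < n) lebesgue_measure (A i))%E.
Proof.
elim: n A => [|n IH] A mA.
  rewrite big_ord0 /= diracE mem_set//; by case.
rewrite big_ord_recl -IH; last by [].
have mB : measurable [set x : rvec R n | forall i, A (lift ord0 i) (tnth x i)].
  rewrite (_ : mkset _ = \big[setI/setT]_(i < n)
     ((fun x : rvec R n => tnth x i) @^-1` A (lift ord0 i))).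
    apply: bigsetI_measurable => i _; rewrite -[X in measurable X]setTI.
    by apply: measurable_tnth => //.
  by rewrite -bigcap_seq; apply/seteqP; split => x /= H i;
    [move=> _; exact: H|exact: (H i (mem_index_enum i))].
rewrite -product_measure1E//=; congr product_measure1.
apply/seteqP; split => [[a x] H|[a x] [/= Aa H] i].
  split=> /=; first by have := H ord0; rewrite /tuple_cons tnth0.
  by move=> i; have := H (lift ord0 i); rewrite /tuple_cons tnthS.
rewrite /tuple_cons; have [j ->|->] := unliftP ord0 i; last by rewrite tnth0.
by rewrite tnthS; exact: H.
Qed.

(* t x + (1 - t) y in R^n (tuples have no lmodType structure). *)
Definition tuple_conv (R : realType) (n : nat) (t : R) (x y : rvec R n) :
  rvec R n := [tuple t * tnth x i + (1 - t) * tnth y i | i < n].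

Definition log_concave (R : realType) (n : nat) (f : rvec R n -> R) : Prop :=
  forall (x y : rvec R n) (t : R), 0 < t -> t < 1 ->
    f x `^ t * f y `^ (1 - t) <= f (tuple_conv t x y).

Definition has_density (R : realType) (n : nat) (d : measure_display)
    (T : measurableType d) (P : probability T R) (X : {RV P >-> rvec R n})
    (f : rvec R n -> R) : Prop :=
  [/\ measurable_fun [set: rvec R n] f,
      (forall x, 0 <= f x) &
      forall A : set (rvec R n), measurable A ->
        distribution P X A = (\int[lebesgue_tuple R n]_(x in A) (f x)%:E)%E].

(* h(X) for X of density f.  Since ln 0 = 0, f log f vanishes where f does.
   If the positive and negative parts of f log f both had infinite integral,
   the value would be +oo (because +oo - +oo = -oo in \bar R). *)
Definition entropy (R : realType) (n : nat) (f : rvec R n -> R) : \bar R :=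
  (- \int[lebesgue_tuple R n]_x (f x * ln (f x))%:E)%E.

Definition sup_norm (R : realType) (n : nat) (f : rvec R n -> R) : \bar R :=
  ess_sup (lebesgue_tuple R n) (EFin \o f).

(* log (||f||_oo ^ (-1/n)), with values in \bar R. The power is taken as
   (||f||_oo^-1) ^ (1/n) because the library sets +oo `^ r = +oo for r < 0;
   here ||f||_oo = +oo gives -oo and ||f||_oo = 0 gives +oo. *)
Definition log_sup_norm_root (R : realType) (n : nat) (f : rvec R n -> R) :
  \bar R := lne (poweR (sup_norm f)^-1%E (n%:R^-1)).

(* Main.v *)
Require Import Defs.
From HB Require Import structures.
From mathcomp Require Import all_boot all_order all_algebra.
From mathcomp Require Import all_classical all_reals all_analysis.
From mathcomp Require Import ess_sup_inf measurable_realfun.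
From mathcomp Require Import ring lra.

(** Write [M] for the essential supremum of [f] and [g] for the integral of
    [f ln f], so that [h(X) = - g].

    For the lower bound on the entropy, [f <= M] almost everywhere gives
    [f ln f <= f ln M], and [f] has integral 1, whence [g <= ln M]
    ([integral_xlnx_le]).

    The upper bound comes from contracting the space towards a point [y] where
    [f y > 0].  For [0 < s < 1], log-concavity and the convexity of the
    exponential give, for every [x],
      [f ((1 - s) x + s y) >= f x `^ (1 - s) * f y `^ s
                           >= f x + s (f x ln (f y) - f x ln (f x))].
    The left-hand side has integral [(1 - s)^-n] by change of variables
    ([ge0_integral_tuple_conv]), so integrating yields
      [(1 - s)^-n >= 1 + s (ln (f y) - g)]
    ([log_concave_integral_xlnx_ge]).  Both sides equal 1 at [s = 0]; comparing
    their slopes there gives [ln (f y) - g <= n] ([le_of_onem_expr_bound]).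
    Hence [f] is bounded everywhere by [exp (n + g)], so that
    [M <= exp (n + g)], which is the upper bound.

    This last step takes [g] to be finite.  The pointwise inequality above, for
    any fixed [s], bounds [f ln f] from below by an integrable function, so [g]
    is never [-oo]; when [g = +oo] the entropy is [-oo] and the upper bound is
    immediate. *)

Set Implicit Arguments.
Unset Strict Implicit.
Unset Printing Implicit Defensive.

Import Order.TTheory GRing.Theory Num.Theory.
Import numFieldNormedType.Exports.

Local Open Scope classical_set_scope.
Local Open Scope ring_scope.

(** * Affine changes of variables *)

Definition affine (R : realType) (t c : R) (x : measurableTypeR R) :
  measurableTypeR R := t * x + c.

Lemma measurable_affine (R : realType) (t c : R) :
  measurable_fun [set: measurableTypeR R] (affine t c).
Proof. by apply: measurable_funD => //; exact: measurable_funM. Qed.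

(** Both sides are measures, so by uniqueness of the Lebesgue measure it is
    enough to compare them on half-open intervals. *)
Lemma lebesgue_measure_affine (R : realType) (t c : R)
    (A : set (measurableTypeR R)) : 0 < t -> measurable A ->
  lebesgue_measure A = (t%:E * pushforward lebesgue_measure (affine t c) A)%E.
Proof.
move=> t0.
apply: (@lebesgue_measure_unique R (mscale (NngNum (ltW t0))
  (pushforward lebesgue_measure (affine t c)))); first exact: measurable_affine.
move=> mf _ [[a b]] _ <-.
transitivity (t%:E * lebesgue_measure (affine t c @^-1` `]a, b]))%E;
  last by [].
have -> : affine t c @^-1` `]a, b] = `](a - c) / t, (b - c) / t]%classic.
  apply/seteqP; split => x /=; rewrite !in_itv/= /affine => /andP[ax xb].
    by rewrite ltr_pdivrMr// ler_pdivlMr//; apply/andP; split; lra.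
  move: ax xb; rewrite ltr_pdivrMr// ler_pdivlMr// => ax xb.
  by apply/andP; split; lra.
rewrite !lebesgue_measure_itv/= !lte_fin ltr_pM2r ?invr_gt0// ltrD2r.
case: ifPn => ab; last by rewrite mule0.
by rewrite -!EFinB -EFinM; congr _%:E; field; rewrite gt_eqF.
Qed.

Lemma ge0_integral_affine (R : realType) (t c : R)
    (g : measurableTypeR R -> \bar R) : 0 < t ->
  measurable_fun [set: measurableTypeR R] g -> (forall x, 0 <= g x)%E ->
  (t%:E * \int[lebesgue_measure]_x g (affine t c x) =
   \int[lebesgue_measure]_x g x)%E.
Proof.
move=> t0 mg g0; have maff := measurable_affine t c.
rewrite [RHS](eq_measure_integral (mscale (NngNum (ltW t0))
  (pushforward lebesgue_measure (affine t c)))); last first.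
  by move=> A mA _; exact: lebesgue_measure_affine.
rewrite ge0_integral_mscale//=; congr (_ * _)%E.
by rewrite ge0_integral_pushforward.
Qed.

Lemma measurable_tuple_conv (R : realType) (n : nat) (t : R) (y : rvec R n) :
  measurable_fun [set: rvec R n] (fun x => tuple_conv t x y).
Proof.
apply/measurable_fun_tnthP => i.
rewrite (_ : _ \o _ = affine t ((1 - t) * tnth y i) \o (fun x => tnth x i)).
  apply: measurableT_comp; first exact: measurable_affine.
  exact: measurable_tnth.
by apply/funext => x /=; rewrite tnth_mktuple.
Qed.

Lemma tuple_conv_cons (R : realType) (n : nat) (t : R) (a : R) (x : rvec R n)
    (y : rvec R n.+1) :
  tuple_conv t (tuple_cons (a, x)) y =
  tuple_cons (affine t ((1 - t) * thead y) a,
              tuple_conv t x [tuple of behead y]).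
Proof.
apply: eq_from_tnth => i; rewrite tnth_mktuple.
have [j ->|->] := unliftP ord0 i; last by rewrite /tuple_cons !tnth0.
rewrite /tuple_cons !tnthS tnth_mktuple tnth_behead; congr (_ + _ * tnth y _).
by apply: val_inj; rewrite /= inordK// ltnS.
Qed.

(** Tonelli's theorem, peeling off the first coordinate. *)
Lemma ge0_integral_lebesgue_tupleS (R : realType) (n : nat)
    (g : rvec R n.+1 -> \bar R) :
  measurable_fun [set: rvec R n.+1] g -> (forall x, 0 <= g x)%E ->
  (\int[lebesgue_tuple R n.+1]_x g x =
   \int[lebesgue_measure]_a \int[lebesgue_tuple R n]_x g (tuple_cons (a, x)))%E.
Proof.
move=> mg g0.
transitivity (\int[lebesgue_measure \x lebesgue_tuple R n]_p
   (g \o @tuple_cons R n) p)%E.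
  have := @ge0_integral_pushforward _ _ _ _ R (@tuple_cons R n)
    (@measurable_tuple_cons R n) (lebesgue_measure \x lebesgue_tuple R n)%E
    setT g.
  rewrite preimage_setT => <- //.
rewrite fubini_tonelli1//; last by move=> p; exact: g0.
by apply: measurableT_comp => //; exact: measurable_tuple_cons.
Qed.

(** The map [x |-> t x + (1 - t) y] acts on each coordinate as an affine map of
    slope [t], so by Tonelli each of the [n] one-dimensional changes of
    variables contributes a factor [t]. *)
Lemma ge0_integral_tuple_conv (R : realType) (n : nat) (t : R) (y : rvec R n)
    (g : rvec R n -> \bar R) : 0 < t ->
  measurable_fun [set: rvec R n] g -> (forall x, 0 <= g x)%E ->
  ((t ^+ n)%:E * \int[lebesgue_tuple R n]_x g (tuple_conv t x y) =
   \int[lebesgue_tuple R n]_x g x)%E.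
Proof.
move=> t0; elim: n y g => [|n IH] y g mg g0.
  rewrite expr0 mul1e; apply: eq_integral => x _.
  by rewrite tuple0 [in RHS]tuple0.
have mcons := @measurable_tuple_cons R n.
have mint : measurable_fun [set: measurableTypeR R] (fun a =>
    \int[lebesgue_tuple R n]_x g (tuple_cons (a, x)))%E.
  apply: (@measurable_fun_fubini_tonelli_F _ _ _ _ _ _ (g \o @tuple_cons R n)).
    exact: measurableT_comp.
  by move=> p; exact: g0.
rewrite [RHS]ge0_integral_lebesgue_tupleS//.
rewrite ge0_integral_lebesgue_tupleS//; last first.
  by apply: measurableT_comp => //; exact: measurable_tuple_conv.
rewrite -(ge0_integral_affine ((1 - t) * thead y) t0 mint); last first.
  by move=> a; exact: integral_ge0.
rewrite exprS EFinM -muleA; congr (_ * _)%E.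
rewrite -ge0_integralZl//=; last 3 first.
- apply: (@measurable_fun_fubini_tonelli_F _ _ _ _ _ _
    (g \o (fun z => tuple_conv t z y) \o @tuple_cons R n)).
    apply: measurableT_comp => //; apply: measurableT_comp => //.
    exact: measurable_tuple_conv.
  by move=> p; exact: g0.
- by move=> a _; exact: integral_ge0.
- by rewrite lee_fin exprn_ge0// ltW.
apply: eq_integral => a _.
under eq_integral do rewrite tuple_conv_cons.
rewrite (IH _ (fun x => g (tuple_cons (_, x))))//.
apply: measurableT_comp => //.
exact: measurable_cons (measurable_cst _) (@measurable_id _ _ _).
Qed.

(** * Monotonicity of the integral almost everywhere *)

(** Comparing positive and negative parts separately makes the statement valid
    for functions whose integrals are infinite or take the default value of
    [+oo - +oo]. *)
Lemma ae_le_integral d (T : measurableType d) (R : realType)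
    (mu : {measure set T -> \bar R}) (f g : T -> \bar R) :
  measurable_fun setT f -> measurable_fun setT g ->
  {ae mu, forall x, f x <= g x}%E ->
  (\int[mu]_x f x <= \int[mu]_x g x)%E.
Proof.
move=> mf mg fg; rewrite integralE [leRHS]integralE; apply: leeB.
  apply: ae_ge0_le_integral => //; try exact: measurable_funepos.
  apply: filterS fg => x fgx _; apply: (@funepos_le _ _ [set x]) => //.
    by move=> z; rewrite inE => ->.
  by rewrite inE.
apply: ae_ge0_le_integral => //; try exact: measurable_funeneg.
apply: filterS fg => x fgx _; apply: (@funeneg_le _ _ [set x]) => //.
  by move=> z; rewrite inE => ->.
by rewrite inE.
Qed.

(** * Real inequalities *)

(** The left-hand side is the tangent at [s = 0] to the right-hand side, which
    is convex in [s]: for [u > 0], writing [u `^ (1 - s) * a `^ s] as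
    [u * exp (s * (ln a - ln u))], this is [1 + z <= exp z]. *)
Lemma powR_tangent_ge (R : realType) (u a s : R) : 0 <= u -> 0 < a ->
  u + s * (u * ln a - u * ln u) <= u `^ (1 - s) * a `^ s.
Proof.
rewrite le_eqVlt => /predU1P[<- a0|u0 a0].
  by rewrite !mul0r subrr mulr0 addr0 mulr_ge0// powR_ge0.
rewrite /powR !gt_eqF//.
have -> : expR ((1 - s) * ln u) * expR (s * ln a) =
    u * expR (s * (ln a - ln u)).
  transitivity (expR (ln u) * expR (s * (ln a - ln u))); last by rewrite lnK.
  by rewrite -!expRD; congr expR; ring.
have := expR_ge1Dx (s * (ln a - ln u)); nra.
Qed.

Lemma bernoulli_ineq (R : realType) (s : R) n : 0 <= s -> s <= 1 ->
  1 - n%:R * s <= (1 - s) ^+ n.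
Proof.
move=> s0 s1; elim: n => [|n IH]; first by rewrite mul0r subr0 expr0.
rewrite exprS; have : (1 - s) * (1 - n%:R * s) <= (1 - s) * (1 - s) ^+ n.
  by apply: ler_wpM2l => //; lra.
apply: le_trans; rewrite -natr1.
have : 0 <= n%:R * s * s by rewrite !mulr_ge0.
lra.
Qed.

(** At [s = 0] the product equals 1 and has derivative [c - n], which must
    therefore be nonpositive.  The proof replaces the derivative by
    Bernoulli's inequality at one small [s]. *)
Lemma le_of_onem_expr_bound (R : realType) (c : R) n : (0 < n)%N ->
  (forall s, 0 < s -> s < 1 -> (1 + s * c) * (1 - s) ^+ n <= 1) -> c <= n%:R.
Proof.
move=> n0 H; rewrite leNgt; apply/negP => nc.
have nge1 : 1 <= n%:R :> R by rewrite ler1n.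
have c0 : 0 < c by lra.
(* chosen so that the second-order term [n * s * c] is half of [c - n] *)
pose s := (c - n%:R) / (2 * n%:R * c).
have nc0 : 0 < 2 * n%:R * c by rewrite !mulr_gt0//; lra.
have nsc : n%:R * s * c = (c - n%:R) / 2.
  by rewrite /s; field; apply/andP; split; lra.
have s0 : 0 < s by rewrite divr_gt0//; lra.
have s1 : s < 1 by rewrite ltr_pdivrMr// mul1r; nra.
have h1 := H s s0 s1.
have h2 := bernoulli_ineq n (ltW s0) (ltW s1).
have h3 : (1 + s * c) * (1 - n%:R * s) <= (1 + s * c) * (1 - s) ^+ n.
  by apply: ler_wpM2l => //; nra.
have : s * (c - n%:R - n%:R * s * c) <= 0 by nra.
rewrite nsc; nra.
Qed.

(** * Densities on R^n *)

Section density.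
Variables (R : realType) (n : nat) (f : rvec R n -> R).
Hypotheses (mf : measurable_fun [set: rvec R n] f) (f0 : forall x, 0 <= f x).
Hypothesis f1 : (\int[lebesgue_tuple R n]_x (f x)%:E = 1)%E.

Lemma measurable_xlnx :
  measurable_fun [set: rvec R n] (fun x => (f x * ln (f x))%:E).
Proof.
apply/measurable_EFinP; apply: measurable_funM => //.
by apply: measurableT_comp => //; exact: measurable_ln.
Qed.

Lemma integrable_density : (lebesgue_tuple R n).-integrable setT (EFin \o f).
Proof.
apply/integrableP; split; first exact/measurable_EFinP.
under eq_integral do rewrite /= ger0_norm//.
by rewrite f1 ltry.
Qed.

Lemma ae_density_le_sup_norm :
  {ae lebesgue_tuple R n, forall x, (f x)%:E <= sup_norm f}%E.
Proof. exact: ess_sup_ge. Qed.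

Lemma sup_norm_gt0 : (0 < sup_norm f)%E.
Proof.
rewrite ltNge; apply/negP => sup0.
suff : (\int[lebesgue_tuple R n]_x (f x)%:E <= \int[lebesgue_tuple R n]_x 0)%E.
  by rewrite f1 integral0 lee_fin ler10.
apply: ae_le_integral => //; first exact/measurable_EFinP.
by apply: filterS ae_density_le_sup_norm => x /le_trans; exact.
Qed.

Lemma exists_density_gt0 : exists x, 0 < f x.
Proof.
apply: contrapT => /forallNP fle0; have := sup_norm_gt0.
apply/negP; rewrite -leNgt.
by apply: ess_sup_ler => x; rewrite lee_fin leNgt; exact/negP.
Qed.

Lemma integral_xlnx_le (r : R) : sup_norm f = r%:E ->
  (\int[lebesgue_tuple R n]_x (f x * ln (f x))%:E <= (ln r)%:E)%E.
Proof.
move=> fr; have r0 : 0 < r by have := sup_norm_gt0; rewrite fr lte_fin.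
rewrite (_ : (ln r)%:E =
    \int[lebesgue_tuple R n]_x ((ln r)%:E * (f x)%:E))%E; last first.
  by rewrite integralZl//= ?f1 ?mule1//; exact: integrable_density.
apply: ae_le_integral; first exact: measurable_xlnx.
  by apply: measurable_funeM; exact/measurable_EFinP.
apply: filterS ae_density_le_sup_norm => x; rewrite fr -EFinM !lee_fin => fxr.
have [->|fx0] := eqVneq (f x) 0; first by rewrite mul0r mulr0.
have {}fx0 : 0 < f x by rewrite lt_neqAle eq_sym fx0 f0.
by rewrite mulrC ler_pM2r// ler_ln.
Qed.

Lemma integral_density_conv (t : R) (y : rvec R n) : 0 < t ->
  (\int[lebesgue_tuple R n]_x (f (tuple_conv t x y))%:E = ((t ^+ n)^-1)%:E)%E.
Proof.
move=> t0.
have tn0 : t ^+ n != 0 by rewrite expf_neq0// gt_eqF.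
rewrite -[LHS]mul1e -(mulVf tn0) EFinM -muleA.
rewrite (@ge0_integral_tuple_conv R n t y (EFin \o f) t0)/= ?f1 ?mule1//.
exact/measurable_EFinP.
Qed.

Lemma integrable_density_conv (t : R) (y : rvec R n) : 0 < t ->
  (lebesgue_tuple R n).-integrable setT (fun x => (f (tuple_conv t x y))%:E).
Proof.
move=> t0; apply/integrableP; split.
  apply/measurable_EFinP; apply: measurableT_comp => //.
  exact: measurable_tuple_conv.
under eq_integral do rewrite /= ger0_norm//.
by rewrite integral_density_conv// ltry.
Qed.

Hypothesis lcf : log_concave f.

(** The inequality [(1 - s)^-n >= 1 + s (ln (f y) - g)] solved for [g], the
    integral of [f ln f]: in this form it is meaningful even if [g] is infinite,
    and it shows that [g] is not [-oo]. *)
Lemma log_concave_integral_xlnx_ge (y : rvec R n) (s : R) :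
  0 < f y -> 0 < s -> s < 1 ->
  ((s^-1 * (1 + s * ln (f y)) - s^-1 * ((1 - s) ^+ n)^-1)%:E <=
   \int[lebesgue_tuple R n]_x (f x * ln (f x))%:E)%E.
Proof.
move=> fy0 s0 s1; have t0 : 0 < 1 - s by lra.
set k := s^-1 * (1 + _).
pose F x := (k%:E * (f x)%:E)%E.
pose H x := (s^-1%:E * (f (tuple_conv (1 - s) x y))%:E)%E.
have iF : (lebesgue_tuple R n).-integrable setT F.
  by apply: integrableZl => //; exact: integrable_density.
have iH : (lebesgue_tuple R n).-integrable setT H.
  by apply: integrableZl => //; exact: integrable_density_conv.
have <- : (\int[lebesgue_tuple R n]_x (F x - H x) =
    (k - s^-1 * ((1 - s) ^+ n)^-1)%:E)%E.
  rewrite integralB// /F /H integralZl//; last exact: integrable_density.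
  rewrite integralZl//; last exact: integrable_density_conv.
  by rewrite f1 mule1 integral_density_conv.
apply: ae_le_integral; [|exact: measurable_xlnx|].
  exact/measurable_int/(integrableB measurableT iF iH).
apply: aeW => x; rewrite /F /H -!EFinM -EFinB lee_fin.
have lc : f x `^ (1 - s) * f y `^ s <= f (tuple_conv (1 - s) x y).
  by have := @lcf x y (1 - s) t0; rewrite subKr; apply; lra.
have := le_trans (powR_tangent_ge s (f0 x) fy0) lc => tangent.
rewrite -(ler_pM2l s0).
have -> : s * (k * f x - s^-1 * f (tuple_conv (1 - s) x y)) =
    (1 + s * ln (f y)) * f x - f (tuple_conv (1 - s) x y).
  by rewrite /k; field; rewrite gt_eqF.
by lra.
Qed.

(** The family of inequalities [(1 - s)^-n >= 1 + s (ln (f y) - g)], compared to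
    first order as [s] tends to 0. *)
Lemma log_concave_ln_le (y : rvec R n) (g : R) : (0 < n)%N -> 0 < f y ->
  (\int[lebesgue_tuple R n]_x (f x * ln (f x))%:E = g%:E)%E ->
  ln (f y) <= n%:R + g.
Proof.
move=> n0 fy0 fg; rewrite -lerBlDr; apply: le_of_onem_expr_bound => // s s0 s1.
have := log_concave_integral_xlnx_ge fy0 s0 s1; rewrite fg lee_fin.
have T0 : 0 < (1 - s) ^+ n by rewrite exprn_gt0// subr_gt0.
rewrite -ler_pdivlMr// mul1r -mulrBr mulrC ler_pdivrMr//; lra.
Qed.

Lemma log_sup_norm_rootE (r : R) : (0 < n)%N -> sup_norm f = r%:E ->
  log_sup_norm_root f = (- (n%:R^-1 * ln r))%:E.
Proof.
move=> n0 fr; have r0 : 0 < r by have := sup_norm_gt0; rewrite fr lte_fin.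
rewrite /log_sup_norm_root fr inver gt_eqF// poweR_EFin lne_EFin.
  by rewrite ln_powR lnV// mulrN.
by rewrite powR_gt0// invr_gt0.
Qed.

Lemma log_sup_norm_root_le_entropy : (0 < n)%N ->
  (log_sup_norm_root f <= (n%:R^-1)%:E * entropy f)%E.
Proof.
move=> n0; case fr : (sup_norm f) => [r| |].
- rewrite (log_sup_norm_rootE n0 fr) EFinN EFinM -muleN lee_wpmul2l//.
  by rewrite leeN2 integral_xlnx_le.
- rewrite /log_sup_norm_root fr invey poweR0r ?invr_neq0 ?pnatr_eq0 -?lt0n//.
  by rewrite le0_lneNy// leNye.
- by have := sup_norm_gt0; rewrite fr.
Qed.

Lemma entropy_le_log_sup_norm_root : (0 < n)%N ->
  ((n%:R^-1)%:E * entropy f <= 1 + log_sup_norm_root f)%E.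
Proof.
move=> n0; rewrite /entropy.
have n0' : 0 < n%:R :> R by rewrite ltr0n.
case Eg : (\int[lebesgue_tuple R n]_x (f x * ln (f x))%:E)%E => [g| |].
- have fle x : f x <= expR (n%:R + g).
    have [->|fx0] := eqVneq (f x) 0; first exact: expR_ge0.
    have {}fx0 : 0 < f x by rewrite lt_neqAle eq_sym fx0 f0.
    by rewrite -ler_ln ?posrE ?expR_gt0// expRK; exact: log_concave_ln_le.
  have : (sup_norm f <= (expR (n%:R + g))%:E)%E.
    by apply: ess_sup_ler => x; rewrite lee_fin.
  have := sup_norm_gt0; case fr : (sup_norm f) => [r| |]//.
  rewrite lte_fin lee_fin (log_sup_norm_rootE n0 fr) => r0.
  rewrite -ler_ln ?posrE ?expR_gt0// expRK => lnr.
  rewrite -EFinN -EFinM -EFinD lee_fin.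
  rewrite -[X in X - _](@mulVf _ n%:R) ?gt_eqF// -mulrBr ler_pM2l ?invr_gt0//.
  lra.
- by rewrite /= gt0_muleNy ?lte_fin ?invr_gt0// leNye.
- have [y fy0] := exists_density_gt0.
  have half0 : 0 < 2^-1 :> R by lra.
  have half1 : 2^-1 < 1 :> R by lra.
  by have := log_concave_integral_xlnx_ge fy0 half0 half1; rewrite Eg.
Qed.

End density.

(** * Entropy of a log-concave density *)

Theorem theorem2p3 (R : realType) (n : nat) (d : measure_display)
    (T : measurableType d) (P : probability T R) (X : {RV P >-> rvec R n})
    (f : rvec R n -> R) :
  (1 <= n)%N ->
  has_density X f ->
  log_concave f ->
  (log_sup_norm_root f <= (n%:R^-1)%:E * entropy f)%E /\
  ((n%:R^-1)%:E * entropy f <= 1 + log_sup_norm_root f)%E.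
Proof.
move=> n0 [mf f0 fX] lcf.
have f1 : (\int[lebesgue_tuple R n]_x (f x)%:E = 1)%E.
  by rewrite -fX// probability_setT.
split; first exact: log_sup_norm_root_le_entropy.
exact: entropy_le_log_sup_norm_root.
Qed.
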